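(* Let $G$ be a partial group. Let $K$ be a normal partial subgroup of $G$, and let $N$ be a partial subgroup of $K$ that is also a normal partial subgroup of $G$. Then $K/N$ is a normal partial subgroup of $G/N$, and there is a natural isomorphism of partial groups $$(G/N)/(K/N)\longrightarrow G/K,\qquad aN.(K/N)\longmapsto aK .$$
   Context: Let $\Gamma$ be a group with neutral element $e$, and let juxtaposition denote its product. Two subgroups $E,\widetilde D$ of $\Gamma$ are supplement in $\Gamma$ if $E\cap\widetilde D=\{e\}$ and $\{xd: x\in E, d\in\widetilde D\}=\Gamma$. A subset $D\subset\Gamma$ is free with $E$ in $\Gamma$ if $e\in D$ and there is a subgroup $\widetilde D\supset D$ that is a supplement of $E$ in $\Gamma$. A partial group $G=E.D$ with support $E$ and defect $D$ is given by a group $\Gamma$, a subgroup $E$ and a subset $D$ free with $E$ in $\Gamma$: its underlying set is $G=E.D=\{xd: x\in E,d\in D\}\subset\Gamma$ (each $a\in G$ is written uniquely as $a=xd$, $x\in E$, $d\in D$), with the partial law $a.b:=xy$ for $a=xd$, $b=yd'$ ($x,y\in E$, $d,d'\in D$). For $a=xd\in G$, $Inv(a)=\{x^{-1}d': d'\in D\}$. Every group is regarded as a partial group with support itself and defect $\{e\}$. A subset $H\subset G$ is a partial subgroup of $G$ if $e\in H$, $a.b\in H$ for all $a,b\in H$, and $Inv(a)\cap H\ne\emptyset$ for all $a\in H$; it is regarded as a partial group with support $E\cap H$, defect $D\cap H$ and the restricted law. For $a\in G$: $aH=\{a.h:h\in H\}$, $Ha=\{h.a:h\in H\}$. $H$ is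 normal in $G$ if $aH=Ha$ for all $a\in G$. If $N$ is a normal partial subgroup of $G$, $G/N$ is the group of cosets $aN$ ($a\in G$) with operation $(aN)(bN)=(a.b)N$, and, for a partial subgroup $K\supset N$, $K/N=\{aN:a\in K\}$. A homomorphism of partial groups $f:G_1=E_1.D_1\to G_2=E_2.D_2$ is a map with $f(E_1)\subset E_2$, $f(D_1)\subset D_2$ and $f(g.h).e=f(g).f(h)$ for all $g,h\in G_1$ (with $e$ the neutral element of $G_2$). An isomorphism is a homomorphism that is one-to-one and onto. *)

(* Defs.v *)
From HB Require Import structures.
From mathcomp Require Import all_boot.
From mathcomp Require Import boolp classical_sets functions.

Set Implicit Arguments.
Unset Strict Implicit.
Unset Printing Implicit Defensive.

Local Open Scope classical_set_scope.
Local Open Scope group_scope.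

(* Groups are MathComp's [groupType] (not necessarily finite); the
   [choiceType] that it carries costs nothing in classical logic. *)

Definition is_subgroup (T : groupType) (E : set T) : Prop :=
  group_closed [in E].

Definition supplement (T : groupType) (E D : set T) : Prop :=
  E `&` D = [set 1] /\ [set x * d | x in E & d in D] = [set: T].

Definition free_with (T : groupType) (E D : set T) : Prop :=
  D 1 /\ exists D' : set T, [/\ is_subgroup D', D `<=` D' & supplement E D'].

Record partialGroup := PartialGroup {
  ambient :> groupType;
  supp : set ambient;
  defect : set ambient;
  supp_subgroup : is_subgroup supp;
  defect_free : free_with supp defect
}.
Arguments supp : clear implicits.
Arguments defect : clear implicits.

Section PartialGroupTheory.
Variable G : partialGroup.
Implicit Types (a b x d : G) (H K N : set G).

Definition carrier : set G := [set x * d | x in supp G & d in defect G].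

(* The factor [x] of [a = x * d]; by [spartM] it is determined by [a].  It is
   the junk value 1 when [a] is not in the carrier. *)
Definition spart a : G :=
  xget 1 [set x | supp G x /\ exists2 d, defect G d & a = x * d].

Definition pmul a b : G := spart a * spart b.

Definition pinv a : set G := [set (spart a)^-1 * d | d in defect G].

Definition partial_subgroup H : Prop :=
  [/\ H `<=` carrier,
      H 1,
      forall a b, H a -> H b -> H (pmul a b) &
      forall a, H a -> pinv a `&` H !=set0].

(* [H] is a partial subgroup of the partial subgroup [K]: the elements of [K]
   are multiplied as in [G], but the defect of [K], which enters [Inv], is only
   [defect G `&` K]. *)
Definition partial_subgroup_in K H : Prop :=
  [/\ H `<=` K,
      H 1,
      forall a b, H a -> H b -> H (pmul a b) &
      forall a, H a ->
        [set (spart a)^-1 * d | d in defect G `&` K] `&` H !=set0].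

Definition plcoset a H : set G := [set pmul a h | h in H].
Definition prcoset H a : set G := [set pmul h a | h in H].

Definition pnormal H : Prop :=
  forall a, carrier a -> plcoset a H = prcoset H a.

Definition normal_partial_subgroup H : Prop := partial_subgroup H /\ pnormal H.

Definition cosets N : set (set G) := [set plcoset a N | a in carrier].

Lemma supp1 : supp G 1.
Proof. by have [/set_mem] := supp_subgroup G. Qed.

Lemma suppF x y : supp G x -> supp G y -> supp G (x / y).
Proof.
have [_ h] := supp_subgroup G => sx sy.
by apply/set_mem/h; apply/mem_set.
Qed.

Lemma suppV x : supp G x -> supp G x^-1.
Proof. by move=> sx; rewrite -div1g; apply: suppF => //; exact: supp1. Qed.

Lemma suppM x y : supp G x -> supp G y -> supp G (x * y).
Proof. by move=> sx sy; rewrite -[y]invgK; apply: suppF => //; exact: suppV. Qed.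

Lemma defect1 : defect G 1.
Proof. by have [] := defect_free G. Qed.

Lemma carrierM x d : supp G x -> defect G d -> carrier (x * d).
Proof. by move=> sx dd; exists x => //; exists d. Qed.

Lemma spartM x d : supp G x -> defect G d -> spart (x * d) = x.
Proof.
move=> sx dd; apply: xget_unique; first by split=> //; exists d.
move=> y [sy [d' dd' eq_xd]].
have [_ [D' [[_ D'F] sDD' [ID' _]]]] := defect_free G.
have D'e : D' (d' / d).
  by apply/set_mem/D'F; apply/mem_set; exact: sDD'.
have e : y^-1 * x = d' / d by rewrite -[x](mulgK d) eq_xd -mulgA mulKg.
have : [set 1 : G] (y^-1 * x).
  rewrite -ID'; split; last by rewrite e.
  by apply: suppM => //; exact: suppV.
by move=> /= yx1; rewrite -[x](mulVKg y) yx1 mulg1.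
Qed.

Lemma spart_supp a : supp G (spart a).
Proof. by rewrite /spart; case: xgetP => [x _ []|_] //; exact: supp1. Qed.

Lemma spart_id x : supp G x -> spart x = x.
Proof. by move=> sx; rewrite -[x in LHS]mulg1 spartM//; exact: defect1. Qed.

Lemma supp_carrier x : supp G x -> carrier x.
Proof. by move=> sx; rewrite -[x]mulg1; apply: carrierM => //; exact: defect1. Qed.

Lemma pmul_supp a b : supp G (pmul a b).
Proof. by apply: suppM; exact: spart_supp. Qed.

Lemma pmul_carrier a b : carrier (pmul a b).
Proof. exact/supp_carrier/pmul_supp. Qed.

Lemma spart_pmul a b : spart (pmul a b) = spart a * spart b.
Proof. exact/spart_id/pmul_supp. Qed.

Lemma plcoset_spart a H : plcoset (spart a) H = plcoset a H.
Proof.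
by rewrite /plcoset /pmul (spart_id (spart_supp a)).
Qed.

Lemma plcoset_cosets a H : cosets H (plcoset a H).
Proof.
by exists (spart a); [exact/supp_carrier/spart_supp|exact: plcoset_spart].
Qed.

Section NormalSubgroup.
Variables (N : set G) (hN : normal_partial_subgroup N).

Let N1 : N 1. Proof. by have [[]] := hN. Qed.

Let NM a b : N a -> N b -> N (pmul a b).
Proof. by have [[_ _ + _] _] := hN; exact. Qed.

Let N_spart a : N a -> N (spart a).
Proof. by move=> Na; have := NM Na N1; rewrite /pmul (spart_id supp1) mulg1. Qed.

Let N_spartV a : N a -> N (spart a)^-1.
Proof.
move=> Na; have [[_ _ _ /(_ _ Na)[_ [[d dd <-] Nd]]] _] := hN.
by have := N_spart Nd; rewrite spartM//; apply/suppV/spart_supp.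
Qed.

Lemma plcosetE a : plcoset a N = [set x | supp G x /\ N ((spart a)^-1 * x)].
Proof.
rewrite eqEsubset; split => [_ [n Nn <-]|x [sx Nx]] /=.
  by split; [exact: pmul_supp|rewrite /pmul mulKg; exact: N_spart].
exists ((spart a)^-1 * x) => //.
rewrite /pmul [spart (_ * _)]spart_id ?mulVKg//.
by apply: suppM => //; apply/suppV/spart_supp.
Qed.

Lemma eq_plcosetP a b :
  plcoset a N = plcoset b N <-> N ((spart a)^-1 * spart b).
Proof.
split=> [ab|Nab].
  have : plcoset b N (spart b).
    by rewrite plcosetE; split; [exact: spart_supp|rewrite mulVg].
  by rewrite -ab plcosetE => -[].
have sab : supp G ((spart a)^-1 * spart b).
  by apply: suppM; [apply/suppV/spart_supp|exact: spart_supp].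
rewrite !plcosetE eqEsubset; split=> x /= [sx Nx]; split => //.
  have sax : supp G ((spart a)^-1 * x).
    by apply: suppM => //; apply/suppV/spart_supp.
  have := NM (N_spartV Nab) Nx.
  rewrite /pmul (spart_id sax) (spart_id (suppV (spart_supp _))) (spart_id sab).
  by rewrite invgM invgK -mulgA mulVKg.
have sbx : supp G ((spart b)^-1 * x).
  by apply: suppM => //; apply/suppV/spart_supp.
have := NM Nab Nx; rewrite /pmul (spart_id sab) (spart_id sbx).
by rewrite -mulgA mulVKg.
Qed.

Lemma normal_conj x n : supp G x -> N n -> N (x^-1 * spart n * x).
Proof.
move=> sx Nn; have [_ /(_ x (supp_carrier sx)) nN] := hN.
have : prcoset N x (pmul n x) by exists n.
rewrite -nN plcosetE => -[_].
by rewrite /pmul (spart_id sx) mulgA.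
Qed.

Lemma plcosetM a a' b b' : plcoset a N = plcoset a' N ->
  plcoset b N = plcoset b' N -> plcoset (pmul a b) N = plcoset (pmul a' b') N.
Proof.
move=> /eq_plcosetP Na /eq_plcosetP Nb; apply/eq_plcosetP.
rewrite !spart_pmul.
have sa : supp G ((spart a)^-1 * spart a').
  by apply: suppM; [apply/suppV/spart_supp|exact: spart_supp].
have sb : supp G ((spart b)^-1 * spart b').
  by apply: suppM; [apply/suppV/spart_supp|exact: spart_supp].
have Nc := normal_conj (spart_supp b) Na.
have sc : supp G ((spart b)^-1 * spart ((spart a)^-1 * spart a') * spart b).
  by do 2![apply: suppM; try exact: spart_supp]; apply/suppV/spart_supp.
have := NM Nc Nb; rewrite /pmul (spart_id sc) (spart_id sb) (spart_id sa).
by rewrite -!mulgA mulVKg invgM -!mulgA.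
Qed.

End NormalSubgroup.
End PartialGroupTheory.

Definition quotient (G : partialGroup) (N : set G)
  (hN : normal_partial_subgroup N) : Type := set_type (cosets N).

(* The coset [aN] as an element of [G/N]. *)
Definition pcoset (G : partialGroup) (N : set G)
    (hN : normal_partial_subgroup N) (a : G) : quotient hN :=
  exist _ (plcoset a N) (mem_set (plcoset_cosets a N)).

Section Quotient.
Variables (G : partialGroup) (N : set G) (hN : normal_partial_subgroup N).

HB.instance Definition _ := Choice.on (quotient hN).

Lemma eq_pcosetP (a b : G) :
  pcoset hN a = pcoset hN b <-> plcoset a N = plcoset b N.
Proof.
split=> [/(congr1 set_val)//|ab].
exact/val_inj.
Qed.

Definition qrepr (A : quotient hN) : G :=
  xget 1 [set a | carrier a /\ pcoset hN a = A].

Lemma qreprP (A : quotient hN) : carrier (qrepr A) /\ pcoset hN (qrepr A) = A.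
Proof.
apply: (@xgetPex _ _ [set a | carrier a /\ pcoset hN a = A]).
have /set_mem[a Ga aN] := valP A.
by exists a; split=> //; apply/val_inj.
Qed.

Definition qmul (A B : quotient hN) : quotient hN :=
  pcoset hN (pmul (qrepr A) (qrepr B)).
Definition qone : quotient hN := pcoset hN 1.
Definition qinv (A : quotient hN) : quotient hN :=
  pcoset hN (spart (qrepr A))^-1.

Lemma qmulE (a b : G) :
  qmul (pcoset hN a) (pcoset hN b) = pcoset hN (pmul a b).
Proof.
by apply/eq_pcosetP/plcosetM => //; apply/eq_pcosetP; exact: (qreprP _).2.
Qed.

Lemma qmulA : associative qmul.
Proof.
move=> A B C; rewrite -(qreprP A).2 -(qreprP B).2 -(qreprP C).2 !qmulE.
by rewrite /pmul !(spart_id (pmul_supp _ _)) mulgA.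
Qed.

Lemma pcoset_spart a : pcoset hN (spart a) = pcoset hN a.
Proof. exact/eq_pcosetP/plcoset_spart. Qed.

Lemma qmul1 : left_id qone qmul.
Proof.
move=> A; rewrite -(qreprP A).2 qmulE /pmul (spart_id (supp1 G)) mul1g.
exact: pcoset_spart.
Qed.

Lemma qmulr1 : right_id qone qmul.
Proof.
move=> A; rewrite -(qreprP A).2 qmulE /pmul (spart_id (supp1 G)) mulg1.
exact: pcoset_spart.
Qed.

Lemma qmulV : left_inverse qone qinv qmul.
Proof.
move=> A; rewrite -{2}(qreprP A).2 qmulE /pmul spart_id ?mulVg//.
exact/suppV/spart_supp.
Qed.

Lemma qmulrV : right_inverse qone qinv qmul.
Proof.
move=> A; rewrite -{1}(qreprP A).2 qmulE /pmul (spart_id (suppV _)) ?mulgV//.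
exact/spart_supp.
Qed.

HB.instance Definition _ :=
  isGroup.Build (quotient hN) qmulA qmul1 qmulr1 qmulV qmulrV.

Lemma pcosetM (a b : G) :
  pcoset hN a * pcoset hN b = pcoset hN (pmul a b).
Proof. exact: qmulE. Qed.

Definition quotient_set (K : set G) : set (quotient hN) :=
  [set pcoset hN a | a in K].

End Quotient.
Arguments quotient_set {G N} hN K.

Section GroupAsPartialGroup.
Variable T : groupType.

Lemma setT_subgroup : is_subgroup [set: T].
Proof. by split=> [|x y _ _]; apply/mem_set. Qed.

Lemma set1_free : free_with [set: T] [set 1].
Proof.
split=> //; exists [set 1]; split=> //.
  by split=> [|x y /set_mem -> /set_mem ->]; apply/mem_set; rewrite /= ?divgg.
split; first by rewrite setTI.
rewrite eqEsubset; split=> // x _; exists x => //; exists 1 => //.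
exact: mulg1.
Qed.

Definition pgroup_of : partialGroup := PartialGroup setT_subgroup set1_free.

Lemma carrier_pgroup_of : carrier (G := pgroup_of) = [set: T].
Proof. by rewrite eqEsubset; split=> // x _; exact: supp_carrier. Qed.

End GroupAsPartialGroup.

Definition phom (G1 G2 : partialGroup) (f : G1 -> G2) : Prop :=
  [/\ set_fun (carrier (G := G1)) (carrier (G := G2)) f,
      set_fun (supp G1) (supp G2) f,
      set_fun (defect G1) (defect G2) f &
      forall g h : G1, carrier g -> carrier h ->
        pmul (f (pmul g h)) 1 = pmul (f g) (f h)].

Definition piso (G1 G2 : partialGroup) (f : G1 -> G2) : Prop :=
  phom f /\ set_bij (carrier (G := G1)) (carrier (G := G2)) f.

Definition pquotient (G : partialGroup) (N : set G)
  (hN : normal_partial_subgroup N) : partialGroup := pgroup_of (quotient hN).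

(* Main.v *)
Require Import Defs.
From mathcomp Require Import all_boot.
From mathcomp Require Import boolp classical_sets functions.

(** The law [a.b] of a partial group only sees the supports of [a] and [b], so
    everything reduces to an ordinary group calculation on supports: [aN = bN]
    iff [x^-1 y] lies in [N], where [x] and [y] are the supports of [a] and [b]
    ([eq_pcoset_mem]).  When [K] contains [N], an element [c] of the support
    has its coset [cN] in [K/N] iff [c] itself lies in [K] ([quotient_setE]);
    applied to [c = x^-1 y], this says that [aN] and [bN] are congruent modulo
    [K/N] exactly when [aK = bK] ([third_iso_kernel]).  One direction makes
    [aN.(K/N) |-> aK] well defined and the other makes it injective.  It is
    surjective because every coset has a representative, and multiplicative
    because coset multiplication is computed on representatives.

    Normality of [K/N] is the image under [a |-> aN] of the equality
    [aK = Ka]. *)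

Set Implicit Arguments.
Unset Strict Implicit.
Unset Printing Implicit Defensive.

Local Open Scope classical_set_scope.
Local Open Scope group_scope.

Section PartialSubgroup.
Variables (G : partialGroup) (H : set G) (hH : partial_subgroup H).

(** The support of [a] is the partial product [a.1]. *)
Lemma partial_subgroup_spart a : H a -> H (spart a).
Proof.
have [_ H1 HM _] := hH => Ha.
by have := HM _ _ Ha H1; rewrite /pmul (spart_id (supp1 G)) mulg1.
Qed.

(** [Inv a] consists of the elements whose support is inverse to that of [a],
    and one of them is in [H]. *)
Lemma partial_subgroup_spartV a : H a -> H (spart a)^-1.
Proof.
have [_ _ _ HV] := hH => /HV[_ [[d dd <-]]] /partial_subgroup_spart.
by rewrite spartM//; apply/suppV/spart_supp.
Qed.

Lemma partial_subgroupM x y :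
  supp G x -> supp G y -> H x -> H y -> H (x * y).
Proof.
have [_ _ HM _] := hH => sx sy Hx Hy.
by have := HM _ _ Hx Hy; rewrite /pmul !spart_id.
Qed.

End PartialSubgroup.

Section GroupAsPartialGroup.
Variable T : groupType.
Implicit Types x y : T.

Lemma spart_pgroup_of x : spart (G := pgroup_of T) x = x.
Proof. exact: spart_id. Qed.

Lemma pmul_pgroup_of x y : pmul (G := pgroup_of T) x y = x * y.
Proof. by rewrite /pmul !spart_pgroup_of. Qed.

End GroupAsPartialGroup.

Section Cosets.
Variables (G : partialGroup) (N : set G) (hN : normal_partial_subgroup N).

Lemma eq_pcoset_mem a b :
  pcoset hN a = pcoset hN b <-> N ((spart a)^-1 * spart b).
Proof.
split=> [/eq_pcosetP/(eq_plcosetP hN)//|Nab].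
exact/eq_pcosetP/(eq_plcosetP hN).
Qed.

Lemma pcosetV a : (pcoset hN a)^-1 = pcoset hN (spart a)^-1.
Proof.
apply: (mulgI (pcoset hN a)).
by rewrite mulgV pcosetM /pmul (spart_id (suppV (spart_supp a))) mulgV.
Qed.

Lemma pcosetVM a b :
  (pcoset hN a)^-1 * pcoset hN b = pcoset hN ((spart a)^-1 * spart b).
Proof. by rewrite pcosetV pcosetM /pmul (spart_id (suppV (spart_supp a))). Qed.

(** If [cN = kN] with [k] in [K] of support [y], then [c = y (y^-1 c)], where
    the second factor is in [N], hence in [K].  Without [supp G c] this fails:
    [cN] only determines the support of [c], and changing the defect part of
    [c] can move it out of [K]. *)
Lemma quotient_setE (K : set G) c : partial_subgroup K -> N `<=` K ->
  supp G c -> quotient_set hN K (pcoset hN c) <-> K c.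
Proof.
move=> hK NK sc; split=> [[k Kk /eq_pcoset_mem]|Kc]; last by exists c.
rewrite (spart_id sc) => /NK Kkc.
rewrite -[c](mulVKg (spart k)); apply: (partial_subgroupM hK) => //.
- exact: spart_supp.
- by apply: suppM => //; apply/suppV/spart_supp.
- exact: partial_subgroup_spart.
Qed.

Lemma quotient_set_partial_subgroup (K : set G) : partial_subgroup K ->
  partial_subgroup (G := pquotient hN) (quotient_set hN K).
Proof.
move=> hK; have [_ K1 KM _] := hK; split.
- by rewrite carrier_pgroup_of.
- by exists 1.
- move=> _ _ [a Ka <-] [b Kb <-]; exists (pmul a b); first exact: KM.
  by rewrite pmul_pgroup_of pcosetM.
- move=> _ [a Ka <-]; exists (pcoset hN (spart a)^-1); split.
    by exists 1 => //; rewrite spart_pgroup_of mulg1 pcosetV.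
  by exists (spart a)^-1 => //; exact: (partial_subgroup_spartV hK).
Qed.

Lemma quotient_set_normal (K : set G) : normal_partial_subgroup K ->
  normal_partial_subgroup (G := pquotient hN) (quotient_set hN K).
Proof.
move=> [hK nK]; split; first exact: quotient_set_partial_subgroup.
move=> A _; rewrite -(qreprP A).2; have := nK _ (qreprP A).1.
move: (qrepr A) => a aK; rewrite eqEsubset; split=> _ [_ [k Kk <-] <-];
  rewrite pmul_pgroup_of pcosetM.
- have [k' Kk' <-] : prcoset K a (pmul a k) by rewrite -aK; exists k.
  by exists (pcoset hN k'); [exists k'|rewrite pmul_pgroup_of pcosetM].
- have [k' Kk' <-] : plcoset a K (pmul k a) by rewrite aK; exists k.
  by exists (pcoset hN k'); [exists k'|rewrite pmul_pgroup_of pcosetM].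
Qed.

End Cosets.

Section ThirdIsomorphism.
Variables (G : partialGroup) (K N : set G).
Hypotheses (hK : normal_partial_subgroup K) (hN : normal_partial_subgroup N).
Hypothesis NK : N `<=` K.
Variable hKN : normal_partial_subgroup (G := pquotient hN) (quotient_set hN K).

Lemma third_iso_kernel a b :
  pcoset hKN (pcoset hN a) = pcoset hKN (pcoset hN b) <->
  pcoset hK a = pcoset hK b.
Proof.
have sab : supp G ((spart a)^-1 * spart b).
  by apply: suppM; [apply/suppV/spart_supp|exact: spart_supp].
rewrite !eq_pcoset_mem !spart_pgroup_of pcosetVM.
exact: quotient_setE hK.1 NK sab.
Qed.

(** The representatives are arbitrary; [third_isoE] shows that the value does
    not depend on them. *)
Definition third_iso (X : pquotient hKN) : pquotient hK :=
  pcoset hK (qrepr (qrepr X : quotient hN)).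

Lemma third_isoE a : third_iso (pcoset hKN (pcoset hN a)) = pcoset hK a.
Proof. by apply/third_iso_kernel; rewrite (qreprP _).2 (qreprP _).2. Qed.

Lemma double_pcoset_surj (X : pquotient hKN) :
  exists a, X = pcoset hKN (pcoset hN a).
Proof.
by exists (qrepr (qrepr X : quotient hN)); rewrite (qreprP _).2 (qreprP _).2.
Qed.

Lemma third_isoM (X Y : pquotient hKN) :
  third_iso (X * Y) = third_iso X * third_iso Y.
Proof.
have [a ->] := double_pcoset_surj X; have [b ->] := double_pcoset_surj Y.
by rewrite pcosetM pmul_pgroup_of pcosetM !third_isoE pcosetM.
Qed.

Lemma third_iso_piso : piso third_iso.
Proof.
split; first split.
- by move=> X _; rewrite carrier_pgroup_of.
- by [].
- by move=> _ ->; exact: third_isoE.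
- by move=> X Y _ _; rewrite !pmul_pgroup_of mulg1 third_isoM.
rewrite !carrier_pgroup_of; split=> //.
- move=> X Y _ _.
  have [a ->] := double_pcoset_surj X; have [b ->] := double_pcoset_surj Y.
  by rewrite !third_isoE => /third_iso_kernel.
- move=> A _; exists (pcoset hKN (pcoset hN (qrepr A))) => //.
  by rewrite third_isoE (qreprP A).2.
Qed.

End ThirdIsomorphism.

Theorem theorem1p3 (G : partialGroup) (K N : set G)
    (hK : normal_partial_subgroup K)
    (hNK : partial_subgroup_in K N)
    (hN : normal_partial_subgroup N) :
  exists hKN : normal_partial_subgroup (G := pquotient hN) (quotient_set hN K),
  exists f : pquotient hKN -> pquotient hK,
    piso f /\
    forall a : G, carrier a -> f (pcoset hKN (pcoset hN a)) = pcoset hK a.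
Proof.
have [NK _ _ _] := hNK.
have hKN := quotient_set_normal hN hK.
exists hKN; exists (@third_iso G K N hK hN hKN); split.
- exact: third_iso_piso.
- by move=> a _; exact: third_isoE.
Qed.
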